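(* Let $p$ be a prime and let $\theta\in\mathbb{F}_p((X^{-1}))$ be a counterexample to the $X$-adic Littlewood conjecture over $\mathbb{F}_p$, i.e. $$\inf_{r\geq 0,\ Q\in\mathbb{F}_p[X]\setminus\{0\}} |Q|\cdot\|X^rQ\theta\|\geq c>0$$ for some constant $c$. Then the discrepancy of the two-dimensional van der Corput--Kronecker-type sequence $\big((\varphi_p(n),\langle \theta n(X)\rangle|_p)\big)_{n\geq 0}$ satisfies $$N D_N\big((\varphi_p(n),\langle \theta n(X)\rangle|_p)\big)=\Omega(\log^2 N),$$ that is, there is a constant $c'>0$ depending only on $\theta$ and $p$ such that $N D_N\geq c'\log^2 N$ for infinitely many $N\in\mathbb{N}$.
   Context: For a field $\mathbb{F}$, $\mathbb{F}((X^{-1}))$ is the field of formal Laurent series $\theta=\sum_{i=j}^\infty a_iX^{-i}$ ($j\in\mathbb{Z}$, $a_i\in\mathbb{F}$, $a_j\neq0$). For such $\theta$: $\deg(\theta)=-j$, $|\theta|=2^{-j}$ (and $|0|=0$), the fractional part is $\langle\theta\rangle=\sum_{i\geq\max\{1,j\}}a_iX^{-i}$, and $\|\theta\|=|\langle\theta\rangle|$. For $n\in\mathbb{N}_0$ with base-$p$ expansion $n=n_0+n_1p+n_2p^2+\cdots$ ($n_i\in\{0,\dots,p-1\}$), $n(X)=n_0+n_1X+n_2X^2+\cdots\in\mathbb{F}_p[X]$, where $\mathbb{F}_p$ is identified with $\{0,1,\dots,p-1\}$. The van der Corput radical inverse is $\varphi_p(n)=\sum_{i\ge0}n_ip^{-i-1}$.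 For a Laurent series $\sum_{i\ge1}b_iX^{-i}$ over $\mathbb{F}_p$, the notation $|_p$ means substituting $X=p$ (with coefficients read as integers in $\{0,\dots,p-1\}$), giving the real number $\sum_{i\geq1}b_ip^{-i}\in[0,1)$. The discrepancy of the first $N$ points of a sequence $(\boldsymbol{x}_n)_{n\ge0}$ in $[0,1)^s$ is $D_N=\sup_J\left|\frac{\#\{0\le n<N:\boldsymbol{x}_n\in J\}}{N}-\mathrm{vol}(J)\right|$, the supremum over all boxes $J=\prod_{i=1}^s[a_i,b_i)\subseteq[0,1)^s$. *)

(* Defs.v *)
From HB Require Import structures.
From mathcomp Require Import all_boot all_order all_algebra.
From mathcomp Require Import all_classical all_reals all_analysis.
Set Implicit Arguments. Unset Strict Implicit. Unset Printing Implicit Defensive.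
Import Order.TTheory GRing.Theory Num.Theory.
Import numFieldNormedType.Exports.
Local Open Scope ring_scope.
Local Open Scope classical_set_scope.

(* A formal Laurent series  sum_i a_i X^{-i}  over F is represented by its
   coefficient function  a : int -> F  (a i = coefficient of X^{-i}),
   subject to finitely many positive powers of X. *)
Definition is_laurent (F : Type) (zero : F) (a : int -> F) : Prop :=
  exists j : int, forall i : int, (i < j)%R -> a i = zero.

(* product of a polynomial Q = sum_k q_k X^k with a Laurent series a:
   coefficient of X^{-m} in Q * a is  sum_k q_k a_(m+k). *)
Definition lmulp (F : nzRingType) (Q : {poly F}) (a : int -> F) : int -> F :=
  fun m => \sum_(k < size Q) Q`_k * a (m + k%:Z)%R.

Definition lfrac (F : nzRingType) (a : int -> F) : int -> F :=
  fun i => if (1 <= i)%R then a i else 0.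

(* absolute value |a| = 2^{deg a} = 2^{-j}, j the least index with a_j != 0;
   |0| = 0 *)
Definition labs (R : realType) (F : nzRingType) (a : int -> F) : R :=
  sup ([set 0] `|` [set (2 : R) ^ (- i) | i in [set i : int | a i != 0]]).

Definition ldist (R : realType) (F : nzRingType) (a : int -> F) : R :=
  labs R (lfrac a).

Definition digit (p n i : nat) : nat := (n %/ p ^ i) %% p.

(* n(X) = n_0 + n_1 X + ... in F_p[X]  (n < p^(n+1), so n+1 digits suffice) *)
Definition digitpoly (p n : nat) : {poly 'F_p} :=
  \poly_(i < n.+1) ((digit p n i)%:R : 'F_p).

Definition vdc (R : realType) (p n : nat) : R :=
  \sum_(i < n.+1) (digit p n i)%:R / (p%:R ^+ i.+1).

Definition evalp (R : realType) (p : nat) (b : int -> 'F_p) : R :=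
  limn (series (fun k : nat =>
          (nat_of_ord (b (k.+1)%:Z))%:R / (p%:R ^+ k.+1) : R)).

Definition box_count (R : realType) (x y : nat -> R) (N : nat)
    (a1 b1 a2 b2 : R) : nat :=
  count (fun n => (a1 <= x n < b1) && (a2 <= y n < b2)) (iota 0 N).

Definition discrepancy (R : realType) (x y : nat -> R) (N : nat) : R :=
  sup [set d : R | exists a1 b1 a2 b2 : R,
         [/\ 0 <= a1 <= b1, b1 <= 1, 0 <= a2 <= b2 & b2 <= 1] /\
         d = `| (box_count x y N a1 b1 a2 b2)%:R / N%:R
                - (b1 - a1) * (b2 - a2) |].
Arguments evalp R p b : clear implicits.
Arguments vdc R p n : clear implicits.

(* Main.v *)
Require Import Defs.
From HB Require Import structures.
From mathcomp Require Import all_boot all_order all_algebra.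
From mathcomp Require Import all_classical all_reals all_analysis.
From mathcomp Require Import mxabelem zify ring.
Import Order.TTheory GRing.Theory Num.Theory.
Import numFieldNormedType.Exports.
Set Implicit Arguments. Unset Strict Implicit. Unset Printing Implicit Defensive.
Local Open Scope ring_scope.

(* A counterexample theta has uniformly nondegenerate Hankel blocks: for some t,
   every block with t more rows than columns has full column rank. Write x, y, z
   for the digit sequences of phi_p(n), of <theta n(X)>|_p and of n / p^m, n < p^m.
   - Prescribing j1, j2, j3 leading digits of x, y, z with j1 + j2 + j3 <= m - t
     leaves exactly p^(m - j1 - j2 - j3) integers n; in particular some n0 has
     digit 1 at every L-th place and 0 elsewhere, on a long block of each sequence.
   - Two integers sharing j1, j2, j3 leading digits with j1 + j2 + j3 >= m + t
     are equal.
   Take a box, and N, with upper corner at truncations of the digits of n0. Its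
   nonzero digits cut it into elementary cells, one for each (i1, i2, i3), of
   volume p^-(s + L (i1 + i2 + i3 + 3)). With L = 2 t + 3 each cell is either large,
   hence contains exactly the expected number of points, or small, hence empty
   because its points would be too close to n0. So all cells err in the same
   direction, and the largest empty ones, of the order of m^2 of them with bounded
   expected content, already give an error of order m^2. *)

(** * Linear systems over a finite field *)

(** Full column rank makes the system solvable, and its solutions form a coset of the left kernel of
    [M], of dimension [m - q]. *)
Lemma card_mulmx_fiber (F : finFieldType) m q (M : 'M[F]_(m, q)) (u : 'rV_q) :
  row_full M -> #|[set v : 'rV_m | v *m M == u]| = (#|F| ^ (m - q))%N.
Proof.
move=> Mfull; have [v0 uE] : exists v0, u = v0 *m M.
  by apply/submxP; exact: submx_full.
have -> : [set v : 'rV_m | v *m M == u] = [set v0 + w | w in rowg (kermx M)].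
  apply/setP => v; rewrite inE; apply/eqP/imsetP => [vM|[w + ->]].
    exists (v - v0); last by rewrite addrC subrK.
    by rewrite inE; apply/sub_kermxP; rewrite mulmxBl vM -uE subrr.
  by rewrite inE => /sub_kermxP wM; rewrite mulmxDl wM addr0 -uE.
rewrite card_imset; last exact: addrI.
by rewrite card_rowg mxrank_ker; move: Mfull => /eqP ->.
Qed.

(** * Base-[p] digits of an integer and of its three coordinates *)

Definition xdigit (p n k : nat) : 'F_p := (digit p n k)%:R.

(** The digits of [n] read from the top, padded with 0: in this coordinate the restriction n < N
    becomes an interval condition. *)
Definition zdigit (p m n k : nat) : 'F_p :=
  if (k < m)%N then xdigit p n (m - k.+1) else 0.

Definition ydigit (p : nat) (theta : int -> 'F_p) (n k : nat) : 'F_p :=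
  lmulp (digitpoly p n) theta k.+1%:Z.

Definition agree (T : eqType) (b g : nat -> T) (j : nat) : bool :=
  [forall k : 'I_j, b k == g k].

Lemma agreeP (T : eqType) (b g : nat -> T) (j : nat) :
  reflect (forall k, (k < j)%N -> b k = g k) (agree b g j).
Proof.
apply: (iffP forallP) => [bg k kj|bg k]; last by apply/eqP/bg.
exact/eqP/(bg (Ordinal kj)).
Qed.

(* Full column rank of every Hankel block of [a] with [t] more rows than
   columns: the badly-approximable condition in terms of coefficients. *)
Definition hankel_nondeg (F : nzRingType) (a : nat -> F) (t : nat) : Prop :=
  forall (r e : nat) (q : nat -> F),
    (forall mu, (mu < e + t)%N -> \sum_(k < e) q k * a (r + k + mu)%N = 0) ->
    forall k, (k < e)%N -> q k = 0.

Lemma digit_small p n k m : (0 < p)%N -> (n < p ^ m)%N -> (m <= k)%N ->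
  digit p n k = 0%N.
Proof.
by move=> p0 nm mk; rewrite /digit divn_small ?mod0n// (leq_trans nm)// leq_pexp2l.
Qed.

Lemma digits_sum p n m : (0 < p)%N -> (n < p ^ m)%N ->
  n = (\sum_(k < m) digit p n k * p ^ k)%N.
Proof.
move=> p0; elim: m n => [|m IH] n nm.
  by rewrite big_ord0; case: n nm.
rewrite big_ord_recl /= {1}(divn_eq n p) addnC expn0 muln1.
rewrite {1}/digit expn0 divn1; congr addn.
rewrite {1}(IH (n %/ p)%N); last by rewrite ltn_divLR// -expnSr.
rewrite big_distrl/=; apply: eq_bigr => i _.
by rewrite /digit /bump /= add1n expnS divnMA -mulnA [(_ ^ _ * _)%N]mulnC.
Qed.

Lemma ltn_digit p n k : (0 < p)%N -> (digit p n k < p)%N.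
Proof. exact: ltn_pmod. Qed.

Lemma val_xdigit p n k : prime p -> nat_of_ord (xdigit p n k) = digit p n k.
Proof. by move=> hp; rewrite val_Fp_nat// modn_small// ltn_digit// prime_gt0. Qed.

Lemma xdigit_small p n k m : (0 < p)%N -> (n < p ^ m)%N -> (m <= k)%N -> xdigit p n k = 0.
Proof. by move=> p0 nm mk; rewrite /xdigit (digit_small p0 nm mk). Qed.

Lemma xdigit_inj p m n n' : prime p -> (n < p ^ m)%N -> (n' < p ^ m)%N ->
  (forall k, (k < m)%N -> xdigit p n k = xdigit p n' k) -> n = n'.
Proof.
move=> hp nm nm' e; have p0 := prime_gt0 hp.
rewrite (digits_sum p0 nm) (digits_sum p0 nm'); apply: eq_bigr => i _.
by rewrite -!val_xdigit// e.
Qed.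

Lemma lmulp_widen (F : nzRingType) (Q : {poly F}) (a : int -> F) i K :
  (size Q <= K)%N -> lmulp Q a i = \sum_(k < K) Q`_k * a (i + k%:Z)%R.
Proof.
move=> sQ; rewrite /lmulp (big_ord_widen K (fun k => Q`_k * a (i + k%:Z)%R))//.
rewrite big_mkcond/=; apply: eq_bigr => k _; case: ltnP => // h.
by rewrite nth_default// mul0r.
Qed.

Lemma coef_digitpoly p n k : prime p -> (digitpoly p n)`_k = xdigit p n k.
Proof.
move=> hp; rewrite coef_poly; case: ltnP => // nk; rewrite (@xdigit_small _ _ _ n (prime_gt0 hp))//.
  exact/ltn_expl/prime_gt1.
exact: ltnW.
Qed.

Lemma ydigitE p theta m n k : prime p -> (n < p ^ m)%N ->
  ydigit theta n k = \sum_(l < m) xdigit p n l * theta (k + l).+1%:Z.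
Proof.
move=> hp nm; rewrite /ydigit (@lmulp_widen _ _ _ _ m).
  by apply: eq_bigr => l _; rewrite coef_digitpoly// -addSn PoszD.
by apply/leq_sizeP => l ml; rewrite coef_digitpoly// (xdigit_small (prime_gt0 hp) nm ml).
Qed.

(** * Integers with prescribed digits *)

Definition digitrow p m n : 'rV['F_p]_m := \row_i xdigit p n i.

(** Digits give a bijection between the integers n < p^m and row vectors; prescribed digits thereby
    become linear equations. *)
Lemma sum_digitrow p m (P : pred 'rV['F_p]_m) : prime p ->
  (\sum_(n < p ^ m) P (digitrow p m n) = #|P|)%N.
Proof.
move=> hp; rewrite -sum1_card [RHS]big_mkcond/=.
have bij : bijective (fun n : 'I_(p ^ m) => digitrow p m n).
  apply: inj_card_bij.
    move=> n n' /rowP e; apply/val_inj/(xdigit_inj hp (ltn_ord n) (ltn_ord n')).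
    by move=> k km; have := e (Ordinal km); rewrite !mxE.
  by rewrite card_mx card_Fp// card_ord mul1n.
rewrite (reindex _ (onW_bij _ bij))/=; apply: eq_bigr => n _.
by rewrite unfold_in; case: (P _).
Qed.

(** Prescribing digits is a linear system v M = u in the digits of [n]: the columns of [M] are unit
    vectors for x and z, and a Hankel block for y. It suffices that [M] has full column rank. *)
Lemma count_prescribed_digits p (theta : int -> 'F_p) t m s j1 j3 d
    (g1 g2 g3 : nat -> 'F_p) : prime p ->
  hankel_nondeg (fun i => theta i.+1%:Z) t -> (j1 + j3 + d + t <= m)%N ->
  (\sum_(n < p ^ m) [&& agree (xdigit p n) g1 j1, agree (zdigit p m n) g3 j3 &
      agree (fun k => ydigit theta n (s + k)) g2 d] = p ^ (m - (j1 + j3 + d)))%N.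
Proof.
move=> hp ht jm.
pose A : 'M['F_p]_(m, j1) := \matrix_(l, i) ((l : nat) == i)%:R.
pose B : 'M['F_p]_(m, j3) := \matrix_(l, i) ((l : nat) == m - i.+1)%N%:R.
pose C : 'M['F_p]_(m, d) := \matrix_(l, k) theta (s + k + l).+1%:Z.
pose u := row_mx (row_mx (\row_(i < j1) g1 i) (\row_(i < j3) g3 i)) (\row_(i < d) g2 i).
pose M := row_mx (row_mx A B) C.
have mulA n i : (digitrow p m n *m A) 0 i = xdigit p n i.
  have im : (i < m)%N by have := ltn_ord i; lia.
  rewrite mxE (bigD1 (Ordinal im))//= !mxE eqxx mulr1 big1 ?addr0// => l li.
  by rewrite !mxE (_ : _ == _ = false) ?mulr0//; apply/negbTE.
have mulB n i : (digitrow p m n *m B) 0 i = zdigit p m n i.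
  have im : (m - i.+1 < m)%N by have := ltn_ord i; lia.
  rewrite mxE (bigD1 (Ordinal im))//= !mxE eqxx mulr1 big1 ?addr0 => [|l li].
    by rewrite /zdigit; case: ltnP => //; have := ltn_ord i; lia.
  by rewrite !mxE (_ : _ == _ = false) ?mulr0//; apply/negbTE.
have Mfull : row_full M.
  rewrite /row_full -mxrank_tr; apply: inj_row_free => w wM.
  have {wM}wM l : \sum_i w 0 (lshift _ (lshift _ i)) * A l i
      + \sum_i w 0 (lshift _ (rshift _ i)) * B l i
      + \sum_i w 0 (rshift _ i) * C l i = 0.
    move/rowP: wM => /(_ l); rewrite !mxE big_split_ord/= big_split_ord/= => {}wM.
    by apply: (etrans _ wM); congr (_ + _ + _); apply: eq_bigr => i _; congr (_ * _);
      apply/esym; rewrite [LHS]mxE ?row_mxEl ?row_mxEr.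
  (* The rows from [j1] up to [m - j3], excluded, meet only the Hankel block, and there are at least
     [d + t] of them. *)
  have w2 i : w 0 (rshift _ i) = 0.
    have /(_ (s + j1)%N d (fun k => if insub k is Some k' then w 0 (rshift _ k') else 0)) := ht.
    move=> /(_ _ i (ltn_ord i)); rewrite valK; apply => mu mud.
    have lm : (j1 + mu < m)%N by lia.
    apply: (etrans _ (wM (Ordinal lm))); rewrite [X in _ = X + _ + _]big1 ?add0r => [|k _].
      rewrite [X in _ = X + _]big1 ?add0r => [|k _].
        by apply: eq_bigr => k _; rewrite valK mxE; congr (_ * theta _.+1%:Z) => /=; lia.
      rewrite mxE/= (_ : _ == _ = false) ?mulr0//; have := ltn_ord k; lia.
    rewrite mxE/= (_ : _ == _ = false) ?mulr0//; have := ltn_ord k; lia.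
  have {}wM l : \sum_i w 0 (lshift _ (lshift _ i)) * A l i
      + \sum_i w 0 (lshift _ (rshift _ i)) * B l i = 0.
    by apply: (etrans _ (wM l)); rewrite [X in _ = _ + X]big1 ?addr0// => i _; rewrite w2 mul0r.
  have w1 i : w 0 (lshift _ (lshift _ i)) = 0.
    have im : (i < m)%N by have := ltn_ord i; lia.
    apply: (etrans _ (wM (Ordinal im))); rewrite [X in _ = _ + X]big1 ?addr0 => [|k _].
      rewrite (bigD1 i)//= mxE eqxx mulr1 big1 ?addr0// => k ki.
      by rewrite mxE/= eq_sym (_ : _ == _ = false) ?mulr0//; apply/negbTE.
    rewrite mxE/= (_ : _ == _ = false) ?mulr0//.
    by have := ltn_ord i; have := ltn_ord k; lia.
  have w3 i : w 0 (lshift _ (rshift _ i)) = 0.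
    have im : (m - i.+1 < m)%N by have := ltn_ord i; lia.
    apply: (etrans _ (wM (Ordinal im))); rewrite [X in _ = X + _]big1 ?add0r => [|k _]; last by rewrite w1 mul0r.
    rewrite (bigD1 i)//= mxE eqxx mulr1 big1 ?addr0// => k ki.
    rewrite mxE/= (_ : _ == _ = false) ?mulr0//; apply/negbTE.
    by move: ki; rewrite -val_eqE/=; have := ltn_ord i; have := ltn_ord k; lia.
  by apply/rowP => i; rewrite mxE; case: (split_ordP i) => k ->//; case: (split_ordP k) => {}k ->.
have := card_mulmx_fiber u Mfull; rewrite card_Fp// cardsE => <-.
rewrite -(sum_digitrow (fun v : 'rV_m => v *m M == u) hp).
apply: eq_bigr => n _; congr nat_of_bool; rewrite /= ?unfold_in/=.
rewrite !mul_mx_row; apply/and3P/eqP => [[/agreeP e1 /agreeP e3 /agreeP e2]|].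
  congr row_mx; first congr row_mx.
  - by apply/rowP => i; rewrite mulA mxE e1.
  - by apply/rowP => i; rewrite mulB mxE e3.
  - apply/rowP => i; rewrite [RHS]mxE -e2// (ydigitE theta _ hp (ltn_ord n)) mxE.
    by apply: eq_bigr => l _; rewrite !mxE.
move=> /eq_row_mx[/eq_row_mx[e1 e3] e2]; split; apply/agreeP => k kj.
- by have /rowP/(_ (Ordinal kj)) := e1; rewrite mulA mxE.
- by have /rowP/(_ (Ordinal kj)) := e3; rewrite mulB mxE.
- have /rowP/(_ (Ordinal kj)) := e2; rewrite [RHS]mxE/= => <-.
  rewrite (ydigitE theta _ hp (ltn_ord n)) mxE.
  by apply: eq_bigr => l _; rewrite !mxE.
Qed.

(* If [n <> n0], the difference of the digit polynomials is [X^j1 Q] with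
   [deg Q < m - j1 - j3], so one of the first [j2] digits of [theta X^j1 Q] is nonzero. *)
Lemma agree_inj p (theta : int -> 'F_p) t m j1 j2 j3 n n0 : prime p ->
  hankel_nondeg (fun i => theta i.+1%:Z) t -> (m + t <= j1 + j2 + j3)%N ->
  (n < p ^ m)%N -> (n0 < p ^ m)%N ->
  agree (xdigit p n) (xdigit p n0) j1 ->
  agree (ydigit theta n) (ydigit theta n0) j2 ->
  agree (zdigit p m n) (zdigit p m n0) j3 -> n = n0.
Proof.
move=> hp ht jm nm n0m /agreeP e1 /agreeP e2 /agreeP e3.
apply: (xdigit_inj hp nm n0m) => k km.
have [kj1|j1k] := ltnP k j1; first exact: e1.
have top i : (i < m)%N -> (m - j3 <= i)%N -> xdigit p n i = xdigit p n0 i.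
  move=> im mi; have := e3 (m - i.+1)%N; rewrite /zdigit.
  have -> : (m - i.+1 < m)%N by lia.
  have -> : (m - (m - i.+1).+1)%N = i by lia.
  by apply; lia.
have [mk|kj3] := leqP (m - j3)%N k; first exact: top.
apply/eqP; rewrite -subr_eq0; apply/eqP.
pose q i := xdigit p n (j1 + i)%N - xdigit p n0 (j1 + i)%N.
have := ht j1 (m - j3 - j1)%N q; rewrite /q.
move=> /(_ _ (k - j1)%N); rewrite subnKC//; apply; last by lia.
move=> mu muj.
have /eqP := e2 mu ltac:(lia); rewrite (ydigitE theta _ hp nm) (ydigitE theta _ hp n0m).
rewrite -subr_eq0 -sumrB => /eqP h; apply: etrans h; apply/esym.
rewrite -(big_mkord xpredT (fun l => xdigit p n l * theta (mu + l).+1%:Z -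
   xdigit p n0 l * theta (mu + l).+1%:Z)).
rewrite (big_cat_nat (n := j1))//=; last by lia.
rewrite big_nat_cond big1 ?add0r => [|i]; last by rewrite andbT => /andP[_ /e1 ->]; rewrite subrr.
rewrite (big_cat_nat (n := (m - j3)%N))//=; [|by lia|by lia].
rewrite [X in _ + X]big_nat_cond [X in _ + X]big1 ?addr0 => [|i]; last first.
  by rewrite andbT => /andP[mi im]; rewrite top// subrr.
rewrite -[X in index_iota X _]add0n big_addn big_mkord; apply: eq_bigr => i _.
by rewrite -mulrBl addnC; congr (_ * theta _.+1%:Z); lia.
Qed.

(** * Hankel blocks of a Littlewood counterexample *)

Lemma ldist_le (R : realType) (F : nzRingType) (a : int -> F) K :
  (forall mu, (mu < K)%N -> a mu.+1%:Z = 0) -> ldist R a <= 2 ^- K.+1.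
Proof.
move=> a0; apply: ge_sup; first by exists 0; left.
move=> _ [->|[i /= ai <-]]; first by rewrite invr_ge0 exprn_ge0.
move: ai; rewrite /lfrac; case: ifP => [|_]; last by rewrite eqxx.
case: i => // -[//|mu] _ ai.
have Kmu : (K <= mu)%N by rewrite leqNgt; apply/negP => /a0 am; rewrite am eqxx in ai.
by rewrite -exprnN lef_pV2 ?posrE ?exprn_gt0// ler_eXn2l ?ltr1n.
Qed.

Lemma lmulpXnM (F : nzRingType) (Q : {poly F}) (a : int -> F) r i :
  lmulp ('X^r * Q) a i = lmulp Q a (i + r%:Z).
Proof.
rewrite (@lmulp_widen _ _ _ _ (r + size Q)); last first.
  by apply: (leq_trans (size_polyMleq _ _)); rewrite size_polyXn.
rewrite big_split_ord/= big1 ?add0r => [|k _]; last by rewrite coefXnM ltn_ord mul0r.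
apply: eq_bigr => k _; rewrite coefXnM ltnNge leq_addr/= addKn.
by rewrite PoszD addrA.
Qed.

(** A nonzero kernel vector of a Hankel block, read as a polynomial Q with |Q| <= 2^e, kills the
    first e + t fractional coefficients of X^r Q theta. The product is then at most 2^e / 2^(e + t +
    1), which is below [c] as soon as t > 1/c. *)
Lemma littlewood_hankel (R : realType) (F : nzRingType) (theta : int -> F) (c : R) :
  0 < c ->
  (forall (r : nat) (Q : {poly F}), Q != 0 ->
     c <= (2 : R) ^+ (size Q).-1 * ldist R (lmulp ('X ^+ r * Q) theta)) ->
  exists t, hankel_nondeg (fun i => theta i.+1%:Z) t.
Proof.
move=> c0 hL; exists (Num.bound c^-1) => r e q sum0 k ke.
set t := Num.bound _ in sum0.
pose Q := \poly_(i < e) q i.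
suff Q0 : Q = 0 by have := coef_poly e q k; rewrite -/Q Q0 coef0 ke.
apply/eqP/negPn/negP => Q0; have := hL r Q Q0; apply/negP; rewrite -ltNge.
have sQ : (size Q <= e)%N by exact: size_poly.
have dist : ldist R (lmulp ('X ^+ r * Q) theta) <= 2 ^- (e + t).+1.
  apply: ldist_le => mu mut; rewrite lmulpXnM (lmulp_widen _ _ sQ) -[RHS](sum0 _ mut).
  apply: eq_bigr => i _; rewrite coef_poly ltn_ord -!PoszD.
  by congr (_ * theta _%:Z); lia.
apply: (le_lt_trans (ler_wpM2l (exprn_ge0 _ _) dist)) => //.
rewrite ltr_pdivrMr ?exprn_gt0//.
have ct : 1 < c * 2 ^+ t.+1.
  rewrite mulrC -ltr_pdivrMr// mul1r.
  have /lt_le_trans : c^-1 < t%:R by rewrite archi_boundP// invr_ge0 ltW.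
  apply; rewrite -natrX ler_nat; exact: ltnW (ltnW (ltn_expl _ _)).
apply: (@le_lt_trans _ _ (2 ^+ e)).
  by rewrite ler_eXn2l ?ltr1n// (leq_trans (leq_pred _)).
by rewrite -addnS exprD mulrCA ltr_pMr ?exprn_gt0.
Qed.

Lemma ydigit0 p (theta : int -> 'F_p) k : prime p -> ydigit theta 0 k = 0.
Proof. by move=> hp; rewrite (@ydigitE _ _ 0)// big_ord0. Qed.

(* If the digits of [theta n(X)] are constant from position [j] on, then
   [X^j (X - 1) n(X)] annihilates the fractional part of [theta]. *)
Lemma ydigit_not_eventually_const p (theta : int -> 'F_p) t n j (x : 'F_p) : prime p ->
  hankel_nondeg (fun i => theta i.+1%:Z) t ->
  (forall k, (j <= k)%N -> ydigit theta n k = x) -> n = 0%N.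
Proof.
move=> hp ht yx; have p0 := prime_gt0 hp.
have nn : (n < p ^ n)%N by exact/ltn_expl/prime_gt1.
pose q k := (if k is k'.+1 then xdigit p n k' else 0) - xdigit p n k.
have q0 : forall k, (k < n.+1)%N -> q k = 0.
  apply: (ht j) => mu _.
  have := subrr x; rewrite -{1}(yx (j + mu).+1) -?(yx (j + mu)%N); [|lia|lia].
  rewrite !(ydigitE theta _ hp nn) => h; apply: etrans h.
  under eq_bigr do rewrite mulrBl.
  rewrite sumrB big_ord_recl/= mul0r add0r; congr (_ - _).
    by apply: eq_bigr => i _; congr (_ * theta _.+1%:Z); rewrite /bump/=; lia.
  rewrite big_ord_recr/= (xdigit_small p0 nn)// mul0r addr0.
  by apply: eq_bigr => i _; congr (_ * theta _.+1%:Z); lia.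
have x0 k : (k < n.+1)%N -> xdigit p n k = 0.
  elim: k => [|k IH] kn; have /eqP := q0 _ kn; rewrite /q subr_eq0 => /eqP <-//.
  exact/IH/ltnW.
apply: (xdigit_inj hp nn); first by rewrite expn_gt0 p0.
by move=> k kn; rewrite x0 ?ltnS 1?ltnW// (@xdigit_small _ _ _ 0).
Qed.

(** * Base-[p] expansions of real numbers *)

Definition trunc (R : realType) (p : nat) (b : nat -> 'F_p) (j : nat) : R :=
  \sum_(k < j) (nat_of_ord (b k))%:R / p%:R ^+ k.+1.

(* The half-open condition excludes expansions ending in [p - 1, p - 1, ...]. *)
Definition has_digits (R : realType) (p : nat) (x : R) (b : nat -> 'F_p) : Prop :=
  forall j, trunc R b j <= x < trunc R b j + p%:R ^- j.

Lemma truncS (R : realType) p (b : nat -> 'F_p) j :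
  trunc R b j.+1 = trunc R b j + (nat_of_ord (b j))%:R / p%:R ^+ j.+1.
Proof. by rewrite /trunc big_ord_recr. Qed.

Lemma trunc_le (R : realType) p (b : nat -> 'F_p) i j : (i <= j)%N ->
  trunc R b i <= trunc R b j.
Proof.
elim: j => [|j IH]; first by rewrite leqn0 => /eqP ->.
rewrite leq_eqVlt => /predU1P[->//|/IH /le_trans]; apply.
by rewrite truncS lerDl divr_ge0// exprn_ge0.
Qed.

Lemma ltn_Fp p (x : 'F_p) : prime p -> (x < p)%N.
Proof. by move=> hp; rewrite -{2}(Fp_cast hp). Qed.

(** The right ends of the nested digit intervals move left by this amount: never negative, and
    positive unless the digit is [p - 1]. *)
Lemma trunc_gapS (R : realType) p (b : nat -> 'F_p) j : prime p ->
  trunc R b j + p%:R ^- j - (trunc R b j.+1 + p%:R ^- j.+1) =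
  (p - (b j).+1)%:R / p%:R ^+ j.+1.
Proof.
move=> hp; have p0 : p%:R != 0 :> R by rewrite pnatr_eq0 -lt0n prime_gt0.
rewrite truncS natrB ?ltn_Fp// -natr1 exprS.
by field; rewrite expf_neq0// p0.
Qed.

Lemma trunc_upper_le (R : realType) p (b : nat -> 'F_p) i j : prime p -> (i <= j)%N ->
  trunc R b j + p%:R ^- j <= trunc R b i + p%:R ^- i.
Proof.
move=> hp; elim: j => [|j IH]; first by rewrite leqn0 => /eqP ->.
rewrite leq_eqVlt => /predU1P[->//|/IH]; apply: le_trans.
by rewrite -subr_ge0 trunc_gapS// divr_ge0// exprn_ge0.
Qed.

Lemma trunc_lt_upper (R : realType) p (b : nat -> 'F_p) i j : prime p ->
  trunc R b j < trunc R b i + p%:R ^- i.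
Proof.
move=> hp; have p0 k : 0 < p%:R ^- k :> R.
  by rewrite invr_gt0 exprn_gt0// ltr0n prime_gt0.
have [ij|/ltnW ji] := leqP i j.
  by apply: lt_le_trans (trunc_upper_le R b hp ij); rewrite ltrDl.
by apply: le_lt_trans (trunc_le R b ji) _; rewrite ltrDl.
Qed.

(** Translates elementary intervals into digit prefixes. The intervals are nested, so agreement
    propagates digit by digit. *)
Lemma has_digitsP (R : realType) p (x : R) (b g : nat -> 'F_p) j : prime p ->
  has_digits x b -> (trunc R g j <= x < trunc R g j + p%:R ^- j) = agree b g j.
Proof.
move=> hp xb; have p0 k : 0 < p%:R ^- k :> R.
  by rewrite invr_gt0 exprn_gt0// ltr0n prime_gt0.
apply/idP/agreeP => [|bg]; last first.
  have -> : trunc R g j = trunc R b j by apply: eq_bigr => k _; rewrite bg.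
  exact: xb.
elim: j => [//|j IH] /andP[gx xg] k.
have bgj : forall k, (k < j)%N -> b k = g k.
  apply: IH; rewrite (le_trans (trunc_le R g (leqnSn j)))//=.
  exact: lt_le_trans xg (trunc_upper_le R g hp (leqnSn j)).
rewrite ltnS leq_eqVlt => /predU1P[->|]; last exact: bgj.
have e : trunc R g j = trunc R b j by apply: eq_bigr => i _; rewrite bgj.
have /andP[bx xb'] := xb j.+1.
move: gx xg bx xb'; rewrite !truncS e; set q := _ ^+ _.
have q0 : 0 < q by rewrite exprn_gt0// ltr0n prime_gt0.
set u := trunc _ _ _ => gx xg bx xb'.
have lt_digits (y z : nat) : u + y%:R / q <= x -> x < u + z%:R / q + q^-1 -> (y <= z)%N.
  move=> yx xz; have := le_lt_trans yx xz.
  by rewrite -addrA ltrD2l -[X in _ + X]mul1r -mulrDl ltr_pM2r ?invr_gt0// natr1 ltr_nat.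
by apply/val_inj/eqP; rewrite eqn_leq !lt_digits.
Qed.

Lemma has_digits_trunc (R : realType) p (b : nat -> 'F_p) m : prime p ->
  (forall k, (m <= k)%N -> b k = 0) -> has_digits (trunc R b m) b.
Proof.
move=> hp b0 j; rewrite trunc_lt_upper// andbT.
have [/trunc_le//|mj] := leqP j m.
have -> // : trunc R b j = trunc R b m.
elim: j mj => // j IH; rewrite ltnS leq_eqVlt truncS => /predU1P[<-|mj].
  by rewrite b0//= mul0r addr0.
by rewrite IH// b0 1?ltnW//= mul0r addr0.
Qed.

(** In F_p the digit p - 1 is -1. A different digit at or past position [j] moves the right end
    strictly to the left, so the limit stays inside the half-open interval. *)
Lemma has_digits_evalp (R : realType) p (b : int -> 'F_p) : prime p ->
  (forall j, exists2 k, (j <= k)%N & b k.+1%:Z != -1) ->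
  has_digits (evalp R p b) (fun k => b k.+1%:Z).
Proof.
move=> hp bN1 j; set d := fun k : nat => b k.+1%:Z.
have serE : series (fun k : nat => (nat_of_ord (b k.+1%:Z))%:R / p%:R ^+ k.+1 : R)
    = trunc R d by apply/funext => k; rewrite /series/= big_mkord.
rewrite /evalp serE.
have ndec : {homo trunc R d : i k / (i <= k)%N >-> i <= k} by move=> i k; exact: trunc_le.
have cvgd : cvgn (trunc R d).
  apply: nondecreasing_is_cvgn => //; exists (trunc R d 0 + p%:R ^- 0).
  by move=> _ [k _ <-]; apply/ltW/trunc_lt_upper.
apply/andP; split; first exact: nondecreasing_cvgn_le.
have [k jk bk] := bN1 j.
apply: (@le_lt_trans _ _ (trunc R d k.+1 + p%:R ^- k.+1)).
  by apply: limr_le => //; apply: nearW => i; apply/ltW/trunc_lt_upper.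
apply: lt_le_trans (trunc_upper_le R d hp jk).
rewrite -subr_gt0 trunc_gapS//; apply: divr_gt0; last first.
  by rewrite exprn_gt0// ltr0n prime_gt0.
rewrite ltr0n subn_gt0 ltn_neqAle ltn_Fp// andbT; apply: contra bk => /eqP dp.
by rewrite -subr_eq0 opprK -[b _]natr_Zp natr1 -/(d k) dp pchar_Fp_0.
Qed.

Lemma vdcE (R : realType) p n : prime p -> vdc R p n = trunc R (xdigit p n) n.+1.
Proof. by move=> hp; apply: eq_bigr => k _; rewrite val_xdigit. Qed.

Lemma trunc_zdigit (R : realType) p m n : prime p -> (n < p ^ m)%N ->
  trunc R (zdigit p m n) m = n%:R / p%:R ^+ m.
Proof.
move=> hp nm; have p0 : p%:R != 0 :> R by rewrite pnatr_eq0 -lt0n prime_gt0.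
rewrite {2}(digits_sum (prime_gt0 hp) nm) natr_sum mulr_suml.
rewrite [RHS](reindex_inj rev_ord_inj)/=; apply: eq_bigr => k _.
rewrite /zdigit ltn_ord val_xdigit// natrM natrX -mulrA; congr (_ * _).
have -> : p%:R ^+ m = p%:R ^+ (m - k.+1) * p%:R ^+ k.+1 :> R by rewrite -exprD subnK.
by rewrite invfM mulrA mulfV ?mul1r// expf_neq0.
Qed.

(** * Interval indicators and the discrepancy *)

Lemma sum_indicator (R : realType) (c : nat -> R) w x :
  {homo c : i j / (i <= j)%N >-> i <= j} ->
  nat_of_bool (c 0%N <= x < c w) = (\sum_(i < w) (c i <= x < c i.+1)%R)%N.
Proof.
move=> ndec; elim: w => [|w IH].
  by rewrite big_ord0; case: ltP; rewrite ?andbF// andbT leNgt => ->.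
rewrite big_ord_recr/= -IH; have c0w := ndec _ _ (leq0n w); have cw := ndec _ _ (leqnSn w).
have [xw|wx] := ltP x (c w).
  by rewrite (lt_le_trans xw cw) addn0.
by rewrite (le_trans c0w wx).
Qed.

Lemma discrepancy_ge (R : realType) (x y : nat -> R) N (a1 b1 a2 b2 : R) :
  [/\ 0 <= a1 <= b1, b1 <= 1, 0 <= a2 <= b2 & b2 <= 1] ->
  `|(box_count x y N a1 b1 a2 b2)%:R / N%:R - (b1 - a1) * (b2 - a2)|
    <= discrepancy x y N.
Proof.
move=> box; apply: ub_le_sup; last by exists a1, b1, a2, b2.
(* Frequency and volume are each at most 1. *)
exists 2 => _ [c1 [d1 [c2 [d2 [[/andP[c10 cd1] d11 /andP[c20 cd2] d21] ->]]]]].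
apply: (le_trans (ler_normB _ _)); rewrite (_ : 2 = 1 + 1)//; apply: lerD.
  (* For N = 0 the quotient is 0 by convention. *)
  have [->|N0] := posnP N; first by rewrite invr0 mulr0 normr0.
  rewrite ger0_norm ?divr_ge0// ler_pdivrMr ?ltr0n// mul1r ler_nat.
  by rewrite -{2}(size_iota 0 N) count_size.
rewrite ger0_norm ?mulr_ge0 ?subr_ge0// mulr_ile1 ?subr_ge0//.
  by rewrite (le_trans _ d11)// gerBl.
by rewrite (le_trans _ d21)// gerBl.
Qed.

(** * Cells cut out by sparse digits *)

Definition clip p (b : nat -> 'F_p) (j k : nat) : 'F_p := if (k < j)%N then b k else 0.

Lemma trunc_clip (R : realType) p (b : nat -> 'F_p) i j :
  trunc R (clip b i) (i + j) = trunc R b i.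
Proof.
elim: j => [|j IH].
  by rewrite addn0; apply: eq_bigr => k _; rewrite /clip ltn_ord.
by rewrite addnS truncS IH /clip ltnNge leq_addr/= mul0r addr0.
Qed.

(** Each of the [w] blocks of length [L] from position [s] on ends with its only nonzero digit, a 1,
    so that the truncations at two successive block ends bound an elementary interval. *)
Definition sparse_digits p (b : nat -> 'F_p) (s L w : nat) : Prop :=
  forall k, (k < L * w)%N -> b (s + k)%N = if (L %| k.+1)%N then 1 else 0.

Lemma val_Fp1 p : prime p -> nat_of_ord (1 : 'F_p) = 1%N.
Proof. by move=> hp; rewrite -[1]/(1%:R) val_Fp_nat// modn_small// prime_gt1. Qed.

Lemma sparse_last p (b : nat -> 'F_p) s L w i : (0 < L)%N -> (i < w)%N ->
  sparse_digits b s L w -> b (s + L * i.+1).-1 = 1.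
Proof.
move=> L0 iw bs; have -> : (s + L * i.+1).-1 = (s + (L * i + L.-1))%N by lia.
rewrite bs; last by nia.
by rewrite -addnS prednK// -mulnSr dvdn_mulr.
Qed.

Lemma trunc_sparse (R : realType) p (b : nat -> 'F_p) s L w i : prime p ->
  (0 < L)%N -> (i < w)%N -> sparse_digits b s L w ->
  trunc R b (s + L * i.+1) = trunc R b (s + L * i) + p%:R ^- (s + L * i.+1).
Proof.
move=> hp L0 iw bs.
have flat j : (j < L)%N -> trunc R b (s + L * i + j) = trunc R b (s + L * i).
  elim: j => [|j IH] jL; first by rewrite addn0.
  rewrite addnS truncS IH; last exact: ltnW.
  rewrite -addnA bs; last by nia.
  rewrite -addnS dvdn_addr ?dvdn_mulr// gtnNdvd//.
  by rewrite mul0r addr0.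
have last1 := sparse_last L0 iw bs.
have eL : (s + L * i.+1)%N = (s + L * i + L.-1).+1 by lia.
rewrite {1}eL truncS flat ?prednK// -eL.
by rewrite eL /= in last1; rewrite last1 val_Fp1// mul1r.
Qed.

Lemma sparse_cellE (R : realType) p (x : R) (b g : nat -> 'F_p) s L w i : prime p ->
  (0 < L)%N -> (i < w)%N -> sparse_digits g s L w -> has_digits x b ->
  (trunc R g (s + L * i) <= x < trunc R g (s + L * i.+1)) =
    agree b (clip g (s + L * i)) (s + L * i.+1).
Proof.
move=> hp L0 iw gs xb; rewrite -(has_digitsP (clip g (s + L * i)) (s + L * i.+1) hp xb).
by rewrite (trunc_sparse R hp L0 iw gs) mulnSr addnA trunc_clip.
Qed.

(** The cell prescribes [L] zeros where [g] has [L - 1] zeros and a 1, so only the last digit is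
    lost. *)
Lemma sparse_cell_agree p (b g : nat -> 'F_p) s L w i :
  (0 < L)%N -> (i < w)%N -> sparse_digits g s L w ->
  agree b (clip g (s + L * i)) (s + L * i.+1) -> agree b g (s + L * i.+1).-1.
Proof.
move=> L0 iw gs /agreeP e; apply/agreeP => k kL.
rewrite e; last by lia.
rewrite /clip; case: ltnP => // ik.
have -> : k = (s + (k - s))%N by lia.
rewrite gs; last by nia.
rewrite (_ : (k - s).+1 = L * i + (k - s - L * i).+1)%N; last by lia.
by rewrite dvdn_addr ?dvdn_mulr// gtnNdvd//; lia.
Qed.

(** That last digit is 0 in the cell and 1 in [g]: the point of n0 lies outside its own cells. *)
Lemma sparse_cell_neq p (b g : nat -> 'F_p) s L w i :
  (0 < L)%N -> (i < w)%N -> sparse_digits g s L w ->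
  agree b (clip g (s + L * i)) (s + L * i.+1) -> b <> g.
Proof.
move=> L0 iw gs /agreeP e bg; have /e : ((s + L * i.+1).-1 < s + L * i.+1)%N by lia.
rewrite bg (sparse_last L0 iw gs) /clip; case: ltnP => [|_ /eqP]; first by lia.
by rewrite oner_eq0.
Qed.

(** At most m - t digits are prescribed, so the number of solutions is a power of [p], hence
    positive. In y only a window starting at [s] is prescribed. *)
Lemma exists_sparse p (theta : int -> 'F_p) t L w m s : prime p ->
  hankel_nondeg (fun i => theta i.+1%:Z) t -> (4 * (w * L) + t <= m)%N ->
  exists n0, [/\ (n0 < p ^ m)%N, sparse_digits (xdigit p n0) 0 L w,
    sparse_digits (ydigit theta n0) s L w & sparse_digits (zdigit p m n0) 0 L (2 * w)].
Proof.
move=> hp ht lem; pose g k : 'F_p := if (L %| k.+1)%N then 1 else 0.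
have := @count_prescribed_digits p theta t m s (L * w) (L * (2 * w)) (L * w) g g g hp ht.
have [/existsP[n /and3P[/agreeP e1 /agreeP e3 /agreeP e2]] _|/existsPn none] :=
    boolP [exists n : 'I_(p ^ m), [&& agree (xdigit p n) g (L * w),
      agree (zdigit p m n) g (L * (2 * w)) & agree (fun k => ydigit theta n (s + k)) g (L * w)]].
  by exists n; split.
rewrite big1 => [/(_ ltac:(lia))/esym/eqP|n _]; last by rewrite (negbTE (none n)).
by rewrite expn_eq0 eqn0Ngt prime_gt0.
Qed.

Lemma cell_count p (theta : int -> 'F_p) t L w m s n0 i1 i2 i3 : prime p ->
  hankel_nondeg (fun i => theta i.+1%:Z) t ->
  L = (2 * t + 3)%N -> m = (s + 2 * (w * L) + t)%N -> (n0 < p ^ m)%N ->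
  sparse_digits (xdigit p n0) 0 L w -> sparse_digits (ydigit theta n0) s L w ->
  sparse_digits (zdigit p m n0) 0 L (2 * w) ->
  (i1 < w)%N -> (i2 < w)%N -> (i3 < 2 * w)%N ->
  (\sum_(n < p ^ m) [&& agree (xdigit p n) (clip (xdigit p n0) (0 + L * i1)) (0 + L * i1.+1),
      agree (ydigit theta n) (clip (ydigit theta n0) (s + L * i2)) (s + L * i2.+1) &
      agree (zdigit p m n) (clip (zdigit p m n0) (0 + L * i3)) (0 + L * i3.+1)] =
   if i1 + i2 + i3 + 3 <= 2 * w then p ^ (m - (s + L * (i1 + i2 + i3 + 3))) else 0)%N.
Proof.
move=> hp ht Lt mE n0m sx sy sz iw1 iw2 iw3; have L0 : (0 < L)%N by lia.
case: leqP => h.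
  have := @count_prescribed_digits p theta t m 0 (0 + L * i1.+1) (0 + L * i3.+1)
    (s + L * i2.+1) (clip (xdigit p n0) (0 + L * i1)) (clip (ydigit theta n0) (s + L * i2))
    (clip (zdigit p m n0) (0 + L * i3)) hp ht.
  have -> : (0 + L * i1.+1 + (0 + L * i3.+1) + (s + L * i2.+1) =
     s + L * (i1 + i2 + i3 + 3))%N by lia.
  move=> <-; last by nia.
  by apply: eq_bigr => n _; congr nat_of_bool; congr andb; rewrite andbC.
rewrite big1// => n _; apply/eqP; rewrite eqb0; apply/negP => /and3P[e1 e2 e3].
have nn0 : n = n0 :> nat.
  apply: (agree_inj hp ht _ (ltn_ord n) n0m (sparse_cell_agree L0 iw1 sx e1)
    (sparse_cell_agree L0 iw2 sy e2) (sparse_cell_agree L0 iw3 sz e3)).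
  (* The shared digits number at least s + L (2 w + 1) - 3, which is m + t because L - 3 = 2 t and s
     + 2 w L = m - t. *)
  have : (L * (2 * w + 1) <= L * (i1 + i2 + i3 + 3))%N by rewrite leq_mul2l; lia.
  lia.
by apply: (sparse_cell_neq L0 iw1 sx e1); rewrite nn0.
Qed.

(** * Decomposing the count and the volume of a box *)

(** A tail of digits -1 would be constant, forcing n = 0; but all digits of 0 vanish. *)
Lemma has_digits_ydigit (R : realType) p (theta : int -> 'F_p) t n : prime p ->
  hankel_nondeg (fun i => theta i.+1%:Z) t ->
  has_digits (evalp R p (lmulp (digitpoly p n) theta)) (ydigit theta n).
Proof.
move=> hp ht; apply: has_digits_evalp => // j; apply: contrapT => none.
have yN1 k : (j <= k)%N -> ydigit theta n k = -1.
  by move=> jk; apply/eqP/negPn/negP => yk; apply: none; exists k.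
have n0 := ydigit_not_eventually_const hp ht yN1.
move: (yN1 j (leqnn j)); rewrite n0 ydigit0// => /eqP.
by rewrite eq_sym oppr_eq0 oner_eq0.
Qed.

(** Provides [N]: when N / p^m is a truncation of the digits of n0, the cut n < N falls on the end
    of a cell in the third coordinate. *)
Lemma trunc_natP (R : realType) p (b : nat -> 'F_p) j m : prime p -> (j <= m)%N ->
  exists N : nat, N%:R = p%:R ^+ m * trunc R b j.
Proof.
move=> hp jm; exists (\sum_(k < j) b k * p ^ (m - k.+1))%N.
rewrite natr_sum mulr_sumr; apply: eq_bigr => k _.
rewrite natrM natrX mulrCA; congr (_ * _).
have -> : p%:R ^+ m = p%:R ^+ (m - k.+1) * p%:R ^+ k.+1 :> R.
  by rewrite -exprD subnK// (leq_trans _ jm).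
by rewrite mulfK// expf_neq0// pnatr_eq0 -lt0n prime_gt0.
Qed.

(** With [z] standing for n / p^m, the restriction n < N is a third interval; each of the three
    indicators splits along its partition, and the product is expanded. *)
Lemma box_count_cells (R : realType) (x y z : nat -> R) N P (c1 c2 c3 : nat -> R) w1 w2 w3 :
  {homo c1 : i j / (i <= j)%N >-> i <= j} -> {homo c2 : i j / (i <= j)%N >-> i <= j} ->
  {homo c3 : i j / (i <= j)%N >-> i <= j} -> (N <= P)%N ->
  (forall n, (n < P)%N -> (n < N)%N = (c3 0%N <= z n < c3 w3)) ->
  box_count x y N (c1 0%N) (c1 w1) (c2 0%N) (c2 w2) =
  (\sum_(i1 < w1) \sum_(i2 < w2) \sum_(i3 < w3) \sum_(n < P)
    [&& (c1 i1 <= x n < c1 i1.+1)%R, (c2 i2 <= y n < c2 i2.+1)%R &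
        (c3 i3 <= z n < c3 i3.+1)%R])%N.
Proof.
move=> h1 h2 h3 NP zN.
pose A n := c1 0%N <= x n < c1 w1; pose B n := c2 0%N <= y n < c2 w2.
transitivity (\sum_(n < P) A n * (B n * (n < N)))%N.
  rewrite /box_count -sum1_count -[N in iota 0 N]subn0 -/(index_iota 0 N) big_mkord.
  rewrite (big_ord_widen_cond P (fun n => A n && B n) (fun=> 1%N))//.
  rewrite big_mkcond/=; apply: eq_bigr => n _.
  by case: (A n); case: (B n); case: (n < N)%N.
under eq_bigr => n _.
  rewrite zN ?ltn_ord// /A /B !sum_indicator//.
  rewrite big_distrl/=.
  under eq_bigr => i1 _.
    rewrite big_distrl/= big_distrr/=.
    under eq_bigr => i2 _ do rewrite !big_distrr/=.
    over.
  over.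
rewrite exchange_big/=; apply: eq_bigr => i1 _.
rewrite exchange_big/=; apply: eq_bigr => i2 _.
rewrite exchange_big/=; apply: eq_bigr => i3 _.
by apply: eq_bigr => n _; rewrite !mulnb.
Qed.

Lemma volume_cells (R : realType) (c1 c2 c3 : nat -> R) w1 w2 w3 :
  (c1 w1 - c1 0%N) * (c2 w2 - c2 0%N) * (c3 w3 - c3 0%N) =
  \sum_(i1 < w1) \sum_(i2 < w2) \sum_(i3 < w3)
    ((c1 i1.+1 - c1 i1) * (c2 i2.+1 - c2 i2) * (c3 i3.+1 - c3 i3)).
Proof.
have tele (c : nat -> R) w : c w - c 0%N = \sum_(i < w) (c i.+1 - c i).
  by rewrite -(big_mkord xpredT (fun i => c i.+1 - c i)) telescope_sumr.
rewrite (tele c1) (tele c2) (tele c3) mulr_suml mulr_suml; apply: eq_bigr => i1 _.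
rewrite [X in X * _]mulr_sumr mulr_suml; apply: eq_bigr => i2 _.
by rewrite mulr_sumr.
Qed.

(** * The quadratic lower bound *)

Lemma discrepancy_lower (R : realType) p (theta : int -> 'F_p) t L w m : prime p ->
  hankel_nondeg (fun i => theta i.+1%:Z) t -> L = (2 * t + 3)%N -> (0 < w)%N ->
  m = (4 * (w * L) + t)%N ->
  exists N : nat, [/\ (w < N)%N, (N <= p ^ m)%N &
    (w%:R * w%:R) / p%:R ^+ (t + 3) <=
      N%:R * discrepancy (fun n => vdc R p n)
                         (fun n => evalp R p (lmulp (digitpoly p n) theta)) N].
Proof.
move=> hp ht Lt w0 mE; have L0 : (0 < L)%N by lia.
set x := fun n => vdc R p n; set y := fun n => evalp R p _.
pose z n : R := n%:R / p%:R ^+ m.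
(* Leaving the first [s] digits of y unprescribed gives [m] the size 4 w L + t needed for n0, while
   the last exactly filled cells are those with i1 + i2 + i3 + 3 = 2 w. *)
pose s := (2 * (w * L))%N; have msE : m = (s + 2 * (w * L) + t)%N by lia.
have p0 : 0 < p%:R :> R by rewrite ltr0n prime_gt0.
have pn0 k : p%:R ^+ k != 0 :> R by rewrite expf_neq0// gt_eqF.
have [n0 [n0m sx sy sz]] : exists n0, [/\ (n0 < p ^ m)%N, sparse_digits (xdigit p n0) 0 L w,
    sparse_digits (ydigit theta n0) s L w & sparse_digits (zdigit p m n0) 0 L (2 * w)].
  by apply: exists_sparse hp ht _; rewrite mE.
pose c1 i : R := trunc R (xdigit p n0) (0 + L * i).
pose c2 i : R := trunc R (ydigit theta n0) (s + L * i).
pose c3 i : R := trunc R (zdigit p m n0) (0 + L * i).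
have ndec (b : nat -> 'F_p) k : {homo (fun i => trunc R b (k + L * i)) : i j / (i <= j)%N >-> i <= j}.
  by move=> i j ij; rewrite trunc_le// leq_add2l leq_mul2l ij orbT.
have xd n : has_digits (x n) (xdigit p n).
  rewrite /x vdcE//; apply: has_digits_trunc => // k nk.
  by apply: (@xdigit_small _ _ _ n.+1) => //; [exact: prime_gt0|exact/ltnW/ltn_expl/prime_gt1].
have yd n : has_digits (y n) (ydigit theta n) by exact: has_digits_ydigit hp ht.
have zd n : (n < p ^ m)%N -> has_digits (z n) (zdigit p m n).
  move=> nm; rewrite /z -(trunc_zdigit R hp nm); apply: has_digits_trunc => // k mk.
  by rewrite /zdigit ltnNge mk.
have L2w : (0 + L * (2 * w) <= m)%N by lia.
have [N NE] := trunc_natP R (zdigit p m n0) hp L2w.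
have c30 : c3 0%N = 0 by rewrite /c3 muln0 addn0 /trunc big_ord0.
have c10 : c1 0%N = 0 by rewrite /c1 muln0 addn0 /trunc big_ord0.
have c_le1 (v : R) (b : nat -> 'F_p) k : has_digits v b -> 0 <= trunc R b k <= 1.
  move=> vb; apply/andP; split.
    by have := trunc_le R b (leq0n k); rewrite /trunc big_ord0.
  have /andP[kv _] := vb k; have /andP[_] := vb 0%N.
  by rewrite {1}/trunc big_ord0 add0r expr0 invr1 => /ltW; exact: le_trans.
have c3N : N%:R / p%:R ^+ m = c3 (2 * w)%N by rewrite NE mulrAC mulfV ?mul1r.
have Np : (N <= p ^ m)%N.
  rewrite -(ler_nat R) natrX NE -[leRHS]mulr1 ler_pM2l ?exprn_gt0//.
  by have /andP[] := c_le1 _ _ (0 + L * (2 * w))%N (zd _ n0m).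
have zN n : (n < p ^ m)%N -> (n < N)%N = (c3 0%N <= z n < c3 (2 * w)%N).
  move=> nm; rewrite c30 /z divr_ge0 ?exprn_ge0//= -c3N.
  by rewrite ltr_pM2r ?invr_gt0 ?exprn_gt0// ltr_nat.
have c1S i : (i < w)%N -> c1 i.+1 - c1 i = p%:R ^- (0 + L * i.+1).
  by move=> iw; rewrite /c1 (trunc_sparse R hp L0 iw sx) addrC addKr.
have c2S i : (i < w)%N -> c2 i.+1 - c2 i = p%:R ^- (s + L * i.+1).
  by move=> iw; rewrite /c2 (trunc_sparse R hp L0 iw sy) addrC addKr.
have c3S i : (i < 2 * w)%N -> c3 i.+1 - c3 i = p%:R ^- (0 + L * i.+1).
  by move=> iw; rewrite /c3 (trunc_sparse R hp L0 iw sz) addrC addKr.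
(* The first cell in z has length p^-L, so N >= p^(m - L), which exceeds [w]. *)
have wN : (w < N)%N.
  have : (p ^ (m - L) <= N)%N.
    rewrite -(ler_nat R) natrX NE.
    have -> : p%:R ^+ m = p%:R ^+ (m - L) * p%:R ^+ L :> R.
      by rewrite -exprD subnK//; nia.
    rewrite -mulrA ler_pMr ?exprn_gt0// mulrC -ler_pdivrMr ?exprn_gt0// mul1r.
    have := c3S 0%N ltac:(lia); rewrite c30 subr0 muln1 add0n => <-.
    by apply: (ndec (zdigit p m n0) 0%N 1%N (2 * w)%N); lia.
  apply: leq_trans; apply: leq_trans (ltn_expl _ (prime_gt1 hp)).
  by rewrite ltnS; nia.
exists N; split=> //.
have N0 : 0 < N%:R :> R by rewrite ltr0n (leq_trans _ wN).
have /andP[_ c1w1] := c_le1 _ _ (0 + L * w)%N (xd n0).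
have /andP[c20 _] := c_le1 _ _ (s + L * 0)%N (yd n0).
have /andP[_ c2w1] := c_le1 _ _ (s + L * w)%N (yd n0).
have c1le : c1 0%N <= c1 w := ndec _ 0%N _ _ (leq0n w).
have c2le : c2 0%N <= c2 w := ndec _ s _ _ (leq0n w).
have box : [/\ 0 <= c1 0%N <= c1 w, c1 w <= 1, 0 <= c2 0%N <= c2 w & c2 w <= 1].
  by split; rewrite // ?c20 ?c1le ?c2le// c10 lexx.
have dbound := discrepancy_ge x y N box.
apply: (le_trans _ (ler_wpM2l (ltW N0) dbound)).
(* All cells err towards too few points, so the absolute value is bounded below by volume minus
   count. *)
rewrite distrC -[X in X * `|_|]gtr0_norm// -normrM ler_normr; apply/orP; left.
rewrite mulrBr [X in _ - X]mulrCA mulfV ?gt_eqF// mulr1.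
(* The third side has length N / p^m, so the expected count in the plane box is p^m times the volume
   in space. *)
have -> : N%:R * ((c1 w - c1 0%N) * (c2 w - c2 0%N)) =
    p%:R ^+ m * ((c1 w - c1 0%N) * (c2 w - c2 0%N) * (c3 (2 * w)%N - c3 0%N)).
  by rewrite c30 subr0 -c3N; field.
rewrite volume_cells (@box_count_cells _ x y z N (p ^ m) c1 c2 c3 w w (2 * w))//;
  [|exact: ndec|exact: ndec|exact: ndec].
pose d (i1 i2 i3 : nat) : R := p%:R ^+ m / p%:R ^+ (s + L * (i1 + i2 + i3 + 3)) -
  (if i1 + i2 + i3 + 3 <= 2 * w then p ^ (m - (s + L * (i1 + i2 + i3 + 3))) else 0)%N%:R.
rewrite [leRHS](_ : _ = \sum_(i1 < w) \sum_(i2 < w) \sum_(i3 < 2 * w) d i1 i2 i3); last first.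
  rewrite mulr_sumr natr_sum -sumrB; apply: eq_bigr => i1 _.
  rewrite mulr_sumr natr_sum -sumrB; apply: eq_bigr => i2 _.
  rewrite mulr_sumr natr_sum -sumrB; apply: eq_bigr => i3 _.
  rewrite c1S// c2S// c3S// /d -(cell_count hp ht Lt msE n0m sx sy sz)//; congr (_ * _ - _%:R).
    rewrite -!invfM -!exprD; congr (_ ^- _); lia.
  apply: eq_bigr => n _; congr nat_of_bool.
  by rewrite (sparse_cellE hp L0 (ltn_ord i1) sx (xd n)) (sparse_cellE hp L0 (ltn_ord i2) sy (yd n))
    (sparse_cellE hp L0 (ltn_ord i3) sz (zd n (ltn_ord n))).
have d0 i1 i2 i3 : 0 <= d i1 i2 i3.
  rewrite /d; case: leqP => h; last by rewrite subr0 divr_ge0 ?exprn_ge0 ?ltW.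
  have le : (s + L * (i1 + i2 + i3 + 3) <= m)%N.
    have : (L * (i1 + i2 + i3 + 3) <= L * (2 * w))%N by rewrite leq_mul2l h orbT.
    by lia.
  rewrite subr_ge0 natrX ler_pdivlMr ?exprn_gt0// -exprD subnK//.
have d1 i1 i2 : (i1 < w)%N -> (i2 < w)%N -> p%:R ^- (t + 3) <= \sum_(i3 < 2 * w) d i1 i2 i3.
  (* For given [i1] and [i2] this index makes i1 + i2 + i3 + 3 = 2 w + 1, the largest empty cell;
     its expected content is p^-(t + 3) since s + L (2 w + 1) = m + t + 3. *)
  move=> iw1 iw2; have i3w : (2 * w - 2 - i1 - i2 < 2 * w)%N by lia.
  rewrite (bigD1 (Ordinal i3w))//= -[leLHS]addr0 lerD ?sumr_ge0// /d.
  have -> : (i1 + i2 + (2 * w - 2 - i1 - i2) + 3 = 2 * w + 1)%N by lia.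
  rewrite ifF ?subr0; last by lia.
  have -> : (s + L * (2 * w + 1) = m + (t + 3))%N by lia.
  by rewrite [X in _ / X]exprD invfM mulrA mulfV// mul1r.
apply: (@le_trans _ _ (\sum_(i1 < w) \sum_(i2 < w) p%:R ^- (t + 3))).
  by rewrite !sumr_const !card_ord -mulrnA -natrM -[leRHS]mulr_natl.
by apply: ler_sum => i1 _; apply: ler_sum => i2 _; exact: d1.
Qed.

Theorem theorem8 (R : realType) (p : nat) (hp : prime p)
  (theta : int -> 'F_p) (htheta : is_laurent 0 theta)
  (c : R) (hc : 0 < c)
  (hLitt : forall (r : nat) (Q : {poly 'F_p}), Q != 0 ->
     c <= (2 : R) ^+ (size Q).-1 * ldist R (lmulp ('X ^+ r * Q) theta)) :
  exists c' : R, 0 < c' /\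
    forall M : nat, exists N : nat, (M < N)%N /\
      c' * (ln (N%:R : R)) ^+ 2 <=
        N%:R * discrepancy (fun n => vdc R p n)
                           (fun n => evalp R p (lmulp (digitpoly p n) theta)) N.
Proof.
have [t ht] := littlewood_hankel hc hLitt.
(* With w = M + 1 >= 1, L = 2 t + 3 and m = 4 w L + t <= w (4 L + t), the bound N <= p^m gives ln N
   <= K w. *)
pose K : R := (4 * (2 * t + 3) + t)%N%:R * ln p%:R.
have p1 : 1 < p%:R :> R by rewrite ltr1n prime_gt1.
have K0 : 0 < K by apply: mulr_gt0; [rewrite ltr0n addn_gt0 muln_gt0 addn_gt0 orbT|exact: ln_gt0].
have q0 : 0 < p%:R ^+ (t + 3) :> R by rewrite exprn_gt0// (lt_trans ltr01).
exists (p%:R ^- (t + 3) / K ^+ 2); split; first by apply: divr_gt0; [rewrite invr_gt0|exact: exprn_gt0].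
move=> M; have [N [MN Np dN]] := discrepancy_lower R hp ht erefl (ltn0Sn M) erefl.
exists N; split; first exact: ltnW.
apply: le_trans dN; rewrite mulrAC ler_pdivrMr ?exprn_gt0//.
rewrite [leRHS]mulrAC [leRHS]mulrC ler_pM2l ?invr_gt0// -expr2 -exprMn.
have N0 : 0 < N%:R :> R by rewrite ltr0n (leq_trans _ MN).
rewrite ler_pXn2r ?nnegrE//; [|by rewrite ln_ge0// ler1n (leq_trans _ MN)|by rewrite mulr_ge0// ltW].
have p0 : 0 < p%:R :> R by rewrite (lt_trans ltr01).
apply: (@le_trans _ _ (ln (p%:R ^+ (4 * (M.+1 * (2 * t + 3)) + t)))).
  by rewrite ler_ln ?posrE ?exprn_gt0// -natrX ler_nat.
rewrite lnXn// -[leLHS]mulr_natl /K mulrA -natrM ler_pM2r ?ln_gt0// ler_nat; nia.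
Qed.
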